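(* Let $M_2$ be a timelike helicoidal surface of type II in $\mathbb{E}^n_1$ ($n\ge 3$), parametrized by $H_2(u,v)=(x_1(u)+cv,x_2(u),\dots,x_{n-2}(u),x_n(u)\sinh v,x_n(u)\cosh v)$ with $c>0$, let $\phi_0>0$ be a constant, and let $\alpha_2(t)=H_2(u(t),v(t))$ be a smooth curve on $M_2$ with $\dot u(t)\ne0$ for all $t$. Then $\alpha_2$ is a timelike loxodrome with constant angle $\phi_0$ if and only if the following differential equation is satisfied for all $t$ (with $u=u(t)$, $v=v(t)$ and dots denoting derivatives with respect to $t$): (i) if the meridians of $M_2$ are spacelike ($\varepsilon=1$), $$(\sinh^2\phi_0\,(x_n^2(u)+c^2)+c^2x_1'^2(u))\,\dot v^2+2c\cosh^2\phi_0\,x_1'(u)\,\dot u\dot v+\cosh^2\phi_0\,\dot u^2=0;$$ (ii) if the meridians of $M_2$ are timelike ($\varepsilon=-1$), $$(\cosh^2\phi_0\,(x_n^2(u)+c^2)+c^2x_1'^2(u))\,\dot v^2+2c\sinh^2\phi_0\,x_1'(u)\,\dot u\dot v-\sinh^2\phi_0\,\dot u^2=0.$$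
   Context: $\mathbb{E}^n_1$ is $\mathbb{R}^n$ with the metric $\langle\cdot,\cdot\rangle$ given by $dx_1^2+\cdots+dx_{n-1}^2-dx_n^2$, and $\|w\|=\sqrt{|\langle w,w\rangle|}$. A vector $w$ is spacelike if $\langle w,w\rangle>0$ or $w=0$, timelike if $\langle w,w\rangle<0$; a curve is timelike if its velocity is timelike everywhere. Helicoidal surface of type II: let $I\subset\mathbb{R}$ be an open interval, $\beta(u)=(x_1(u),x_2(u),\dots,x_{n-2}(u),0,x_n(u))$, $u\in I$, a smooth regular curve parametrized by arc length, i.e. $x_1'^2+x_2'^2+\cdots+x_{n-2}'^2-x_n'^2=\varepsilon$ with $\varepsilon\in\{1,-1\}$ constant, and $c>0$ a constant. The surface is parametrized by $H_2$ ($u\in I$, $v\in\mathbb{R}$). It is timelike if $EG-F^2<0$ everywhere, where $E=\langle (H_2)_u,(H_2)_u\rangle$, $F=\langle (H_2)_u,(H_2)_v\rangle$, $G=\langle (H_2)_v,(H_2)_v\rangle$; equivalently $c^2(\varepsilon-x_1'^2(u))+\varepsilon x_n^2(u)<0$ for all $u$. The meridians are the curves $u\mapsto H_2(u,v_0)$ with $v_0$ constant; they are spacelike if $\varepsilon=1$ and timelike if $\varepsilon=-1$. Lorentzian angle: for $x$ nonzero spacelike and $y$ timelike, the angle is the unique $\theta\ge0$ with $\langle x,y\rangle=\pm\|x\|\|y\|\sinh\theta$; for $x,y$ both timelike, it is the unique $\theta\ge 0$ with $\langle x,y\rangle=\pm\|x\|\|y\|\cosh\theta$. A timelike loxodrome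 with constant angle $\phi_0$ is a timelike curve $\alpha_2(t)=H_2(u(t),v(t))$ such that, for every $t$, the Lorentzian angle between $\dot\alpha_2(t)$ and the meridian tangent vector $(H_2)_u(u(t),v(t))$ equals $\phi_0$. *)

(* Defs.v *)
From HB Require Import structures.
From mathcomp Require Import all_boot all_order all_algebra.
From mathcomp Require Import all_classical all_reals all_analysis.
Import Order.TTheory GRing.Theory Num.Theory.
Import numFieldNormedType.Exports.

Set Implicit Arguments.
Unset Strict Implicit.
Unset Printing Implicit Defensive.

Local Open Scope ring_scope.
Local Open Scope classical_set_scope.

(* The ambient space E^N_1 with N >= 3 is 'rV[R]_n.+3, where N = n + 3.  The
   informal coordinates 1, N - 1 and N have the 0-based indices ord0, n.+1
   and ord_max; the last one is the timelike direction. *)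

Section LorentzMinkowski.
Variables (R : realType) (n : nat).
Implicit Types (x y w : 'rV[R]_n.+3) (theta : R).

Definition sinh (a : R) : R := (expR a - expR (- a)) / 2.
Definition cosh (a : R) : R := (expR a + expR (- a)) / 2.

Definition lorentz x y : R :=
  (\sum_(i < n.+3 | i != ord_max) x 0 i * y 0 i) - x 0 ord_max * y 0 ord_max.

Definition lnorm w : R := Num.sqrt `|lorentz w w|.

Definition spacelike w : Prop := 0 < lorentz w w \/ w = 0.
Definition timelike w : Prop := lorentz w w < 0.

(* The angle is a relation rather than a function, because it is only defined
   for some pairs of vectors. *)
Definition lorentz_angle x y theta : Prop :=
  (spacelike x /\ x <> 0 /\ timelike y /\
     Logic.unique (fun th : R => 0 <= th /\
       (lorentz x y = lnorm x * lnorm y * sinh th \/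
        lorentz x y = - (lnorm x * lnorm y * sinh th))) theta)
  \/
  (timelike x /\ timelike y /\
     Logic.unique (fun th : R => 0 <= th /\
       (lorentz x y = lnorm x * lnorm y * cosh th \/
        lorentz x y = - (lnorm x * lnorm y * cosh th))) theta).

End LorentzMinkowski.

Definition open_interval (R : realType) (A : set R) : Prop :=
  open A /\ is_interval A /\ A !=set0.

(* On an open set, having derivatives of all orders is being C^infinity. *)
Definition smooth_on (R : realType) (V : normedModType R) (A : set R)
  (f : R -> V) : Prop :=
  forall (k : nat) (t : R), A t -> derivable (derive1n k f) t 1.

Section HelicoidalSurface.
Variables (R : realType) (n : nat).
Implicit Types (I J : set R) (beta : R -> 'rV[R]_n.+3) (c eps phi : R).

Definition first_coord beta (s : R) : R := beta s 0 ord0.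
Definition last_coord beta (s : R) : R := beta s 0 ord_max.

Definition profile_curve I beta eps : Prop :=
  open_interval I /\ smooth_on I beta /\
  (forall (s : R) (i : 'I_n.+3), I s -> (i : nat) = n.+1 -> beta s 0 i = 0) /\
  (forall s : R, I s -> derive1 beta s <> 0) /\
  (eps = 1 \/ eps = -1) /\
  (forall s : R, I s -> lorentz (derive1 beta s) (derive1 beta s) = eps).

Definition H2 c beta (s r : R) : 'rV[R]_n.+3 :=
  \row_(i < n.+3)
    if i == ord0 then first_coord beta s + c * r
    else if i == n.+1 :> nat then last_coord beta s * sinh r
    else if i == ord_max then last_coord beta s * cosh r
    else beta s 0 i.

Definition H2_u c beta (s r : R) : 'rV[R]_n.+3 :=
  derive1 (fun s' : R => H2 c beta s' r) s.
Definition H2_v c beta (s r : R) : 'rV[R]_n.+3 :=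
  derive1 (fun r' : R => H2 c beta s r') r.

Definition coefE c beta (s r : R) : R :=
  lorentz (H2_u c beta s r) (H2_u c beta s r).
Definition coefF c beta (s r : R) : R :=
  lorentz (H2_u c beta s r) (H2_v c beta s r).
Definition coefG c beta (s r : R) : R :=
  lorentz (H2_v c beta s r) (H2_v c beta s r).

Definition timelike_surface I c beta : Prop :=
  forall s r : R, I s ->
    coefE c beta s r * coefG c beta s r - coefF c beta s r ^+ 2 < 0.

Definition timelike_helicoidal_surface_II I c beta eps : Prop :=
  [/\ profile_curve I beta eps, 0 < c & timelike_surface I c beta].

(* H2_u is the velocity of a meridian.  By arc length parametrization these two
   predicates amount to eps = 1 and eps = -1 respectively. *)
Definition spacelike_meridians I c beta : Prop :=
  forall s r : R, I s -> spacelike (H2_u c beta s r).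
Definition timelike_meridians I c beta : Prop :=
  forall s r : R, I s -> timelike (H2_u c beta s r).

Definition surface_curve c beta (u v : R -> R) (t : R) : 'rV[R]_n.+3 :=
  H2 c beta (u t) (v t).

Definition timelike_loxodrome J c beta (u v : R -> R) phi : Prop :=
  (forall t : R, J t -> timelike (derive1 (surface_curve c beta u v) t)) /\
  (forall t : R, J t ->
     lorentz_angle (H2_u c beta (u t) (v t))
                   (derive1 (surface_curve c beta u v) t) phi).

End HelicoidalSurface.

(* Main.v *)
Require Import Defs.
From mathcomp Require Import all_boot all_order all_algebra.
From mathcomp Require Import all_classical all_reals all_analysis.
From mathcomp Require Import ring lra.
Import Order.TTheory GRing.Theory Num.Theory.
Import numFieldNormedType.Exports.

Local Open Scope ring_scope.
Local Open Scope classical_set_scope.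

(* With E = eps, F = c x_1' and G = c^2 + x_n^2 as first fundamental form, put
   P = <H_u, alpha'> = eps u' + F v' and Q = <alpha', alpha'>.  Both equations
   read P^2 + k Q = 0, where k = sinh^2 phi0 or k = cosh^2 phi0, which is the
   angle condition once Q < 0 is known.  Conversely P^2 + k Q = 0 forces Q <= 0,
   and Q = 0 would give P = 0, hence (E G - F^2) v'^2 = eps Q - P^2 = 0, so
   v' = 0 and then u' = 0, which is excluded. *)

(** * Hyperbolic functions: squares and derivatives *)

Section Hyperbolic.
Context {R : realType}.
Implicit Types a b : R.

Lemma sqr_cosh a : cosh a ^+ 2 = 1 + sinh a ^+ 2.
Proof.
have e1 : expR a * expR (- a) = 1 by rewrite expRN mulfV// gt_eqF// expR_gt0.
have <- : cosh a ^+ 2 - sinh a ^+ 2 = 1 by rewrite -[RHS]e1 /cosh /sinh; field.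
by rewrite subrK.
Qed.

(** Stated for squares because the sign ambiguity in the definition of the angle disappears on
    squaring. It holds because [sinh] is strictly increasing, and nonnegative on nonnegative
    arguments. *)
Lemma sqr_sinh_inj a b : 0 <= a -> 0 <= b ->
  sinh a ^+ 2 = sinh b ^+ 2 -> a = b.
Proof.
have mono x y : x < y -> sinh x < sinh y.
  move=> xy; rewrite /sinh ltr_pM2r ?invr_gt0//.
  by apply: ltrB; rewrite ltr_expR ?ltrN2.
have sinh_ge0 x : 0 <= x -> 0 <= sinh x.
  by move=> x0; rewrite /sinh divr_ge0// subr_ge0 ler_expR; lra.
move=> a0 b0 /eqP; rewrite eqrXn2 ?sinh_ge0// => /eqP ab.
by have [/mono|/mono|//] := ltgtP a b; rewrite ab ltxx.
Qed.

Lemma sqr_cosh_inj a b : 0 <= a -> 0 <= b ->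
  cosh a ^+ 2 = cosh b ^+ 2 -> a = b.
Proof. by move=> a0 b0; rewrite !sqr_cosh => /addrI; exact: sqr_sinh_inj. Qed.

Lemma is_derive_sinh a : is_derive a 1 (@sinh R) (cosh a).
Proof.
have E : @sinh R = (fun x => (expR x - (expR \o -%R) x) * 2^-1) by [].
rewrite E; apply: is_derive_eq.
by rewrite /cosh /GRing.scale/=; field.
Qed.

Lemma is_derive_cosh a : is_derive a 1 (@cosh R) (sinh a).
Proof.
have E : @cosh R = (fun x => (expR x + (expR \o -%R) x) * 2^-1) by [].
rewrite E; apply: is_derive_eq.
by rewrite /sinh /GRing.scale/=; field.
Qed.

End Hyperbolic.

(** * The Lorentz form and the angle conditions in squared form *)

Section Lorentz.
Context {R : realType} {n : nat}.
Implicit Types x y z : 'rV[R]_n.+3.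

Lemma lorentzC x y : lorentz x y = lorentz y x.
Proof.
rewrite /lorentz mulrC; congr (_ - _).
by apply: eq_bigr => i _; rewrite mulrC.
Qed.

Lemma lorentzDZl a b x y z :
  lorentz (a *: x + b *: y) z = a * lorentz x z + b * lorentz y z.
Proof.
rewrite /lorentz !mulrBr !mulr_sumr addrACA -big_split/= !mxE.
rewrite -opprD; congr (_ - _); last by ring.
by apply: eq_bigr => i _; rewrite !mxE; ring.
Qed.

Lemma lorentz0l x : lorentz 0 x = 0.
Proof.
by have := lorentzDZl 0 0 0 0 x; rewrite !scale0r addr0 !mul0r addr0.
Qed.

Lemma lorentzDZr a b x y z :
  lorentz z (a *: x + b *: y) = a * lorentz z x + b * lorentz z y.
Proof. by rewrite ![lorentz z _]lorentzC lorentzDZl. Qed.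

Lemma sqr_lnorm x : lnorm x ^+ 2 = `|lorentz x x|.
Proof. by rewrite /lnorm sqr_sqrtr. Qed.

(** The two signs amount to one equation between squares. Since [k] is nonzero, that equation
    determines the square of [f], so injectivity supplies the uniqueness part. Here [f] stands for
    [sinh] or [cosh], and [k] for a product of norms. *)
Lemma unique_angle (f : R -> R) (l k phi : R) :
  (forall a b, 0 <= a -> 0 <= b -> f a ^+ 2 = f b ^+ 2 -> a = b) ->
  k != 0 -> 0 <= phi ->
  Logic.unique (fun th => 0 <= th /\ (l = k * f th \/ l = - (k * f th))) phi
  <-> l ^+ 2 = k ^+ 2 * f phi ^+ 2.
Proof.
move=> finj k0 phi0.
have sqrE th : (l = k * f th \/ l = - (k * f th)) <->
    l ^+ 2 = k ^+ 2 * f th ^+ 2.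
  rewrite -exprMn; split=> [[->|->]//|/eqP]; first by rewrite sqrrN.
  by rewrite eqf_sqr => /orP[] /eqP; [left|right].
split=> [[[_ /sqrE]]//|lE]; split=> [|th [th0 /sqrE]]; first by rewrite sqrE.
rewrite lE => /mulfI /finj; apply=> //.
by rewrite expf_eq0.
Qed.

(** The minus sign comes from the absolute values in the norms, as exactly one of the two Lorentz
    squares is negative. The positive square of [x] rules out the [cosh] branch of the angle. *)
Lemma lorentz_angle_spacelike x y (phi : R) :
  0 < lorentz x x -> timelike y -> 0 <= phi ->
  lorentz_angle x y phi <->
  lorentz x y ^+ 2 = - (lorentz x x * lorentz y y) * sinh phi ^+ 2.
Proof.
rewrite /timelike => xx yy phi0.
have k2 : (lnorm x * lnorm y) ^+ 2 = - (lorentz x x * lorentz y y).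
  by rewrite exprMn !sqr_lnorm gtr0_norm// ltr0_norm// mulrN.
have k0 : lnorm x * lnorm y != 0.
  by rewrite -sqrf_eq0 k2 oppr_eq0 mulf_eq0 (gt_eqF xx) (lt_eqF yy).
rewrite -k2 -(unique_angle _ _ _ _ sqr_sinh_inj)//.
split=> [[[_ [_ [_]]]//|[]]|]; first by rewrite /timelike ltNge ltW.
move=> h; left; split; first by left.
by split=> [x0|//]; move: xx; rewrite x0 lorentz0l ltxx.
Qed.

Lemma lorentz_angle_timelike x y (phi : R) :
  timelike x -> timelike y -> 0 <= phi ->
  lorentz_angle x y phi <->
  lorentz x y ^+ 2 = lorentz x x * lorentz y y * cosh phi ^+ 2.
Proof.
rewrite /timelike => xx yy phi0.
have k2 : (lnorm x * lnorm y) ^+ 2 = lorentz x x * lorentz y y.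
  by rewrite exprMn !sqr_lnorm !ltr0_norm// mulrNN.
have k0 : lnorm x * lnorm y != 0.
  by rewrite -sqrf_eq0 k2 mulf_eq0 (lt_eqF xx) (lt_eqF yy).
rewrite -k2 -(unique_angle _ _ _ _ sqr_cosh_inj)//.
split=> [[[sx [x0 _]]|[_ []]//]|]; last by right.
by case: sx => [|//]; rewrite ltNge ltW.
Qed.

Definition penult : 'I_n.+3 := Ordinal (ltnW (ltnSn n.+2)).

(** Isolates the three coordinates on which the helicoidal motion acts; the remaining sum is
    untouched by it. *)
Lemma lorentz_split x y : lorentz x y =
  x 0 ord0 * y 0 ord0 + x 0 penult * y 0 penult - x 0 ord_max * y 0 ord_max
  + \sum_(i < n.+3 | [&& i != ord_max, i != ord0 & i != penult])
      x 0 i * y 0 i.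
Proof.
rewrite /lorentz (bigD1 ord0)//= (bigD1 penult)//=.
  rewrite addrA [LHS]addrAC; congr (_ + _).
  by apply: eq_bigl => i; rewrite andbA.
by rewrite -!val_eqE /= ltn_eqF.
Qed.

End Lorentz.

(** * Coordinatewise differentiation of row vectors *)

Lemma derive1_row (R : realType) (N : nat) (f : R -> 'rV[R]_N) (t : R)
    (d : 'rV[R]_N) :
  (forall j, is_derive t 1 (fun s => f s 0 j) (d 0 j)) -> derive1 f t = d.
Proof.
move=> fd; have df : derivable f t 1.
  by apply/derivable_mxP => i j; rewrite (ord1 i); exact: @ex_derive (fd j).
rewrite derive1E derive_mx//; apply/rowP => j.
by rewrite mxE; exact: @derive_val (fd j).
Qed.

Lemma is_derive_row (R : realType) (N : nat) (f : R -> 'rV[R]_N) (t : R) j :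
  derivable f t 1 -> is_derive t 1 (fun s => f s 0 j) (derive1 f t 0 j).
Proof.
move=> df; rewrite derive1E derive_mx// mxE.
by apply: derivableP; move/derivable_mxP : df; exact.
Qed.

(** * Tangent vectors of the helicoidal surface and their Lorentz products *)

Section Helicoidal.
Context {R : realType} {n : nat}.
Implicit Types (beta : R -> 'rV[R]_n.+3) (c s r t : R).

(** For [w] with vanishing [penult] coordinate, this is the image of [w] under the Lorentz boost of
    parameter [r] in the plane of the last two coordinates. *)
Definition meridian_velocity (w : 'rV[R]_n.+3) (r : R) : 'rV[R]_n.+3 :=
  \row_(i < n.+3)
    if i == ord0 then w 0 ord0
    else if i == n.+1 :> nat then w 0 ord_max * sinh r
    else if i == ord_max then w 0 ord_max * cosh r
    else w 0 i.

(** Velocity of an orbit of the helicoidal motion: translation at speed [c] along the first axis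
    plus a boost of a point at height [h]. *)
Definition orbit_velocity (c h r : R) : 'rV[R]_n.+3 :=
  \row_(i < n.+3)
    if i == ord0 then c
    else if i == n.+1 :> nat then h * cosh r
    else if i == ord_max then h * sinh r
    else 0.

(** A single chain rule serves three times: with [v] constant and [u] the identity it gives [H2_u],
    with the roles exchanged [H2_v], and in general the velocity of a curve on the surface. *)
Lemma derive1_H2_comp c beta (u v : R -> R) t du dv :
  is_derive t 1 u du -> is_derive t 1 v dv -> derivable beta (u t) 1 ->
  derive1 (fun s => H2 c beta (u s) (v s)) t =
  du *: meridian_velocity (derive1 beta (u t)) (v t)
  + dv *: orbit_velocity c (last_coord beta (u t)) (v t).
Proof.
move=> u' v' b'; apply: derive1_row => j.
have b i : is_derive t 1 ((fun s => beta s 0 i) \o u)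
    (derive1 beta (u t) 0 i * du).
  by apply: is_derive1_comp; exact: is_derive_row.
have S : is_derive t 1 (@sinh R \o v) (cosh (v t) * dv).
  by apply: is_derive1_comp; exact: is_derive_sinh.
have C : is_derive t 1 (@cosh R \o v) (sinh (v t) * dv).
  by apply: is_derive1_comp; exact: is_derive_cosh.
(* The case distinction on [j] is pulled out of the function of [s], so that each kind of coordinate
   is differentiated separately. *)
have -> : (fun s => H2 c beta (u s) (v s) 0 j) =
    if j == ord0 then
      ((fun s => beta s 0 ord0) \o u) + (cst c * v)
    else if j == n.+1 :> nat then
      ((fun s => beta s 0 ord_max) \o u) * (@sinh R \o v)
    else if j == ord_max then
      ((fun s => beta s 0 ord_max) \o u) * (@cosh R \o v)
    else (fun s => beta s 0 j) \o u.
  by apply/funext => s; rewrite !mxE; do ![case: ifP => _ //].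
rewrite !mxE; do ![case: ifP => _].
- by apply: is_derive_eq; rewrite /GRing.scale/=; ring.
- apply: is_derive_eq; rewrite /GRing.scale/= /last_coord; ring.
- apply: is_derive_eq; rewrite /GRing.scale/= /last_coord; ring.
- by apply: is_derive_eq; ring.
Qed.

Lemma H2_uE c beta s r : derivable beta s 1 ->
  H2_u c beta s r = meridian_velocity (derive1 beta s) r.
Proof.
move=> bs; rewrite /H2_u.
rewrite (@derive1_H2_comp c beta id (cst r) s 1 0)//.
by rewrite scale1r scale0r addr0.
Qed.

Lemma H2_vE c beta s r : derivable beta s 1 ->
  H2_v c beta s r = orbit_velocity c (last_coord beta s) r.
Proof.
move=> bs; rewrite /H2_v.
rewrite (@derive1_H2_comp c beta (cst s) id r 0 1)//.
by rewrite scale1r scale0r add0r.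
Qed.

Lemma derive1_surface_curve c beta (u v : R -> R) t :
  derivable u t 1 -> derivable v t 1 -> derivable beta (u t) 1 ->
  derive1 (surface_curve c beta u v) t =
  derive1 u t *: H2_u c beta (u t) (v t)
  + derive1 v t *: H2_v c beta (u t) (v t).
Proof.
move=> du dv db; rewrite H2_uE// H2_vE//.
by apply: derive1_H2_comp; rewrite ?derive1E//; exact: derivableP.
Qed.

Lemma first_coord_derive1 beta s : derivable beta s 1 ->
  derive1 (first_coord beta) s = derive1 beta s 0 ord0.
Proof.
move=> /(is_derive_row _ _ _ _ ord0) b.
by rewrite [LHS]derive1E; exact: @derive_val b.
Qed.

Lemma max_eq_penult : (n.+2 == n.+1) = false.
Proof. by rewrite gtn_eqF. Qed.

(** A boost is an isometry, by [cosh^2 - sinh^2 = 1]. *)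
Lemma lorentz_meridian_velocity (w : 'rV[R]_n.+3) r : w 0 penult = 0 ->
  lorentz (meridian_velocity w r) (meridian_velocity w r) = lorentz w w.
Proof.
move=> wp; rewrite !lorentz_split; congr (_ + _).
  rewrite !mxE !eqxx/= max_eq_penult wp; transitivity (w 0 ord0 ^+ 2
    + w 0 ord_max ^+ 2 * (sinh r ^+ 2 - cosh r ^+ 2)); first by ring.
  by rewrite sqr_cosh; ring.
apply: eq_bigr => i /and3P[im i0 ip].
by rewrite mxE (negbTE i0) (negbTE im) ifN.
Qed.

Lemma lorentz_meridian_orbit_velocity (w : 'rV[R]_n.+3) c h r :
  lorentz (meridian_velocity w r) (orbit_velocity c h r) = c * w 0 ord0.
Proof.
rewrite lorentz_split big1 => [|i /and3P[im i0 ip]].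
  by rewrite !mxE !eqxx/= max_eq_penult; ring.
by rewrite !mxE (negbTE i0) (negbTE im) [X in _ * X]ifN ?mulr0.
Qed.

Lemma lorentz_orbit_velocity c h r :
  lorentz (orbit_velocity c h r) (orbit_velocity c h r) = c ^+ 2 + h ^+ 2.
Proof.
rewrite lorentz_split big1 => [|i /and3P[im i0 ip]].
  rewrite !mxE !eqxx/= max_eq_penult.
  transitivity (c ^+ 2 + h ^+ 2 * (cosh r ^+ 2 - sinh r ^+ 2)); first by ring.
  by rewrite sqr_cosh; ring.
by rewrite !mxE (negbTE i0) (negbTE im) ifN ?mulr0.
Qed.

End Helicoidal.

(** * The first fundamental form *)

Section TimelikeHelicoidal.
Context {R : realType} {n : nat} {I : set R} {beta : R -> 'rV[R]_n.+3}.
Context {eps c : R} (hM : timelike_helicoidal_surface_II I c beta eps).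
Variables (s r : R) (Is : I s).

Lemma profile_curve_derivable : derivable beta s 1.
Proof. by have [[_ [/(_ 0%N s Is)]]] := hM. Qed.

Let beta_s := profile_curve_derivable.

(** The coordinate is known to vanish only on [I]; as [I] is open, it agrees with the zero function
    near [s], which is enough for the derivative. *)
Lemma derive1_profile_curve_penult : derive1 beta s 0 penult = 0.
Proof.
have [[[oI _] [_ [b0 _]]] _ _] := hM.
have b := is_derive_row _ _ _ _ penult beta_s.
rewrite -(@derive_val _ _ _ _ _ _ _ b).
rewrite (@near_eq_derive _ _ _ _ (cst 0)) ?derive_cst//.
by apply: filterS (open_nbhs_nbhs (conj oI Is)) => x Ix; exact: b0.
Qed.

Lemma coefE_eps : Defs.coefE c beta s r = eps.
Proof.
rewrite /Defs.coefE H2_uE// lorentz_meridian_velocity.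
  by have [[_ [_ [_ [_ [_ /(_ s Is)]]]]]] := hM.
exact: derive1_profile_curve_penult.
Qed.

Lemma coefF_first_coord :
  coefF c beta s r = c * derive1 (first_coord beta) s.
Proof.
by rewrite /coefF H2_uE// H2_vE// lorentz_meridian_orbit_velocity
  first_coord_derive1.
Qed.

Lemma coefG_last_coord : coefG c beta s r = c ^+ 2 + last_coord beta s ^+ 2.
Proof. by rewrite /coefG H2_vE// lorentz_orbit_velocity. Qed.

End TimelikeHelicoidal.

(** * Loxodromes and the differential equation, for both kinds of meridians *)

Theorem lemma4p1 (R : realType) (n : nat) (I J : set R)
  (beta : R -> 'rV[R]_n.+3) (eps c phi0 : R) (u v : R -> R)
  (hM : timelike_helicoidal_surface_II I c beta eps)
  (hphi0 : 0 < phi0)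
  (hJ : open_interval J)
  (huI : forall t : R, J t -> I (u t))
  (hu : smooth_on J u)
  (hv : smooth_on J v)
  (hdu : forall t : R, J t -> derive1 u t <> 0) :
  (spacelike_meridians I c beta ->
    (timelike_loxodrome J c beta u v phi0 <->
     forall t : R, J t ->
       (sinh phi0 ^+ 2 * (last_coord beta (u t) ^+ 2 + c ^+ 2)
          + c ^+ 2 * derive1 (first_coord beta) (u t) ^+ 2) * derive1 v t ^+ 2
       + 2 * c * cosh phi0 ^+ 2 * derive1 (first_coord beta) (u t)
           * derive1 u t * derive1 v t
       + cosh phi0 ^+ 2 * derive1 u t ^+ 2 = 0))
  /\
  (timelike_meridians I c beta ->
    (timelike_loxodrome J c beta u v phi0 <->
     forall t : R, J t ->
       (cosh phi0 ^+ 2 * (last_coord beta (u t) ^+ 2 + c ^+ 2)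
          + c ^+ 2 * derive1 (first_coord beta) (u t) ^+ 2) * derive1 v t ^+ 2
       + 2 * c * sinh phi0 ^+ 2 * derive1 (first_coord beta) (u t)
           * derive1 u t * derive1 v t
       - sinh phi0 ^+ 2 * derive1 u t ^+ 2 = 0)).
Proof.
have [_ [_ [t0 Jt0]]] := hJ; have [[_ [_ [_ [_ [eps1 _]]]]] c0 tM] := hM.
have I0 := huI _ Jt0.
have phi_ge0 := ltW hphi0.
pose P t := eps * derive1 u t
  + c * derive1 (first_coord beta) (u t) * derive1 v t.
pose G t := c ^+ 2 + last_coord beta (u t) ^+ 2.
pose Q t := eps * derive1 u t ^+ 2
  + 2 * (c * derive1 (first_coord beta) (u t)) * derive1 u t * derive1 v t
  + G t * derive1 v t ^+ 2.
have uP t (Jt : J t) : derivable u t 1 := hu 0%N t Jt.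
have vP t (Jt : J t) : derivable v t 1 := hv 0%N t Jt.
(* Generalizing these vectors keeps unification from unfolding them. *)
have [U UE] : exists U, U = H2_u c beta by exists (H2_u c beta).
have [V VE] : exists V, V = H2_v c beta by exists (H2_v c beta).
have [A AE] : exists A, A = derive1 (surface_curve c beta u v).
  by exists (derive1 (surface_curve c beta u v)).
have alphaE t : J t ->
    A t = derive1 u t *: U (u t) (v t) + derive1 v t *: V (u t) (v t).
  move=> Jt; rewrite AE UE VE; apply: derive1_surface_curve.
  - exact: uP.
  - exact: vP.
  - exact: profile_curve_derivable hM _ (huI t Jt).
have EE t : J t -> lorentz (U (u t) (v t)) (U (u t) (v t)) = eps.
  by move=> /huI Iu; rewrite UE; exact: coefE_eps hM _ _ Iu.
have FE t : J t -> lorentz (U (u t) (v t)) (V (u t) (v t)) =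
    c * derive1 (first_coord beta) (u t).
  by move=> /huI Iu; rewrite UE VE; exact: coefF_first_coord hM _ _ Iu.
have GE t : J t -> lorentz (V (u t) (v t)) (V (u t) (v t)) = G t.
  by move=> /huI Iu; rewrite VE; exact: coefG_last_coord hM _ _ Iu.
have PE t : J t -> lorentz (U (u t) (v t)) (A t) = P t.
  by move=> Jt; rewrite alphaE// lorentzDZr EE// FE// /P; ring.
have QE t : J t -> lorentz (A t) (A t) = Q t.
  (* Only the left factor is expanded at first, so that its [U] part is already [P t]; the [V] part
     is then expanded by symmetry. *)
  move=> Jt; rewrite {1}alphaE// lorentzDZl PE// lorentzC alphaE// lorentzDZl.
  by rewrite FE// GE// /P /Q; ring.
have G0 t : 0 < G t by rewrite /G ltr_pwDl ?exprn_gt0 ?sqr_ge0.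
have disc t : J t -> eps * G t < (c * derive1 (first_coord beta) (u t)) ^+ 2.
  move=> Jt; have := tM (u t) (v t) (huI t Jt).
  by rewrite /Defs.coefE /coefF /coefG -UE -VE EE// FE// GE// subr_lt0.
have Qneg t k (Jt : J t) : P t ^+ 2 = - k * Q t -> 0 < k -> Q t < 0.
  move=> PQ k0; rewrite ltNge le_eqVlt.
  apply/negP => /orP[/eqP Q0|Q0]; last first.
    have : P t ^+ 2 < 0 by rewrite PQ mulNr oppr_lt0 mulr_gt0.
    by rewrite ltNge sqr_ge0.
  have P0 : P t = 0 by apply/eqP; rewrite -sqrf_eq0 PQ -Q0 mulr0.
  have D := disc t Jt.
  have : (eps * G t - (c * derive1 (first_coord beta) (u t)) ^+ 2)
      * derive1 v t ^+ 2 = 0.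
    (* This identity rests on [eps ^+ 2 = 1], which cancels the terms in [u'^2] and [u' v']. *)
    transitivity (eps * Q t - P t ^+ 2); last by rewrite -Q0 P0; ring.
    by rewrite /Q /P; case: eps1 => ->; ring.
  move/eqP; rewrite mulf_eq0 subr_eq0 (lt_eqF D)/= sqrf_eq0 => /eqP v0.
  apply: (hdu t Jt); move: P0; rewrite /P v0 mulr0 addr0.
  by case: eps1 => ->; rewrite ?mulN1r ?mul1r// => /eqP;
    rewrite oppr_eq0 => /eqP.
(* Common core of both cases. The angle criterion is required only where [Q t < 0]: a loxodrome has
   this by definition, and a solution of the equation has it by [Qneg]. *)
have loxE (K : R) : 0 < K ->
    (forall t, J t -> Q t < 0 ->
       lorentz_angle (U (u t) (v t)) (A t) phi0 <-> P t ^+ 2 = - K * Q t) ->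
    timelike_loxodrome J c beta u v phi0 <->
    forall t, J t -> P t ^+ 2 + K * Q t = 0.
  rewrite /timelike_loxodrome -UE -AE => K0 angE; split=> [[tl ang] t Jt|eq].
    have Q0 : Q t < 0 by rewrite -QE//; exact: tl.
    by rewrite ((angE t Jt Q0).1 (ang t Jt)) mulNr addNr.
  have PQ t : J t -> P t ^+ 2 = - K * Q t.
    by move=> /eq /eqP; rewrite addr_eq0 -mulNr => /eqP.
  have Q0 t (Jt : J t) : Q t < 0 := Qneg t K Jt (PQ t Jt) K0.
  split=> t Jt; first by rewrite /timelike QE//; exact: Q0.
  by apply/angE => //; [exact: Q0|exact: PQ].
(* Strict positivity of [phi0] matters here: at [phi0 = 0] this factor would vanish, while [loxE]
   needs a positive [K]. *)
have sinh_gt0 : 0 < sinh phi0 ^+ 2.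
  by rewrite exprn_gt0// /sinh divr_gt0// subr_gt0 ltr_expR; lra.
have cosh_gt0 : 0 < cosh phi0 ^+ 2 by rewrite sqr_cosh ltr_pwDl ?ltW.
rewrite /spacelike_meridians /timelike_meridians -UE; split=> mer.
  have e1 : eps = 1.
    (* Spacelike vectors include zero, so [eps = -1] is refuted in two ways: -1 is not positive, and
       the zero vector has Lorentz square 0. *)
    case: eps1 => // eN.
    have := mer (u t0) (v t0) I0; rewrite /spacelike EE// eN.
    case=> [|z]; first by rewrite ltr0N1.
    have := EE t0 Jt0; rewrite z eN lorentz0l => /eqP.
    by rewrite eq_sym oppr_eq0 oner_eq0.
  rewrite (loxE (sinh phi0 ^+ 2))//; last first.
    move=> t Jt Q0.
    rewrite lorentz_angle_spacelike ?EE ?e1 ?PE ?QE//.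
      by rewrite mul1r !mulNr mulrC.
    by rewrite /timelike QE.
  (* The [u'^2] and [u' v'] terms collect the factor [1 + sinh^2 = cosh^2]. *)
  have eqE t : (P t ^+ 2 + sinh phi0 ^+ 2 * Q t) =
     (sinh phi0 ^+ 2 * (last_coord beta (u t) ^+ 2 + c ^+ 2)
          + c ^+ 2 * derive1 (first_coord beta) (u t) ^+ 2) * derive1 v t ^+ 2
       + 2 * c * cosh phi0 ^+ 2 * derive1 (first_coord beta) (u t)
           * derive1 u t * derive1 v t
       + cosh phi0 ^+ 2 * derive1 u t ^+ 2.
    by rewrite sqr_cosh /P /Q /G e1; ring.
  by split=> h t Jt; have := h t Jt; rewrite eqE.
have e1 : eps = -1.
  case: eps1 => // e1; have := mer (u t0) (v t0) I0; rewrite /timelike EE// e1.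
  by rewrite ltr10.
rewrite (loxE (cosh phi0 ^+ 2))//; last first.
  move=> t Jt Q0; rewrite lorentz_angle_timelike ?EE ?e1 ?PE ?QE//.
  - by rewrite mulN1r !mulNr mulrC.
  - exact: mer (huI t Jt).
  - by rewrite /timelike QE.
(* With [eps = -1] the [u'^2] term has coefficient [1 - cosh^2 = - sinh^2], and the mixed term
   carries [cosh^2 - 1 = sinh^2]. *)
have eqE t : (P t ^+ 2 + cosh phi0 ^+ 2 * Q t) =
       (cosh phi0 ^+ 2 * (last_coord beta (u t) ^+ 2 + c ^+ 2)
          + c ^+ 2 * derive1 (first_coord beta) (u t) ^+ 2) * derive1 v t ^+ 2
       + 2 * c * sinh phi0 ^+ 2 * derive1 (first_coord beta) (u t)
           * derive1 u t * derive1 v t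
       - sinh phi0 ^+ 2 * derive1 u t ^+ 2.
  by rewrite sqr_cosh /P /Q /G e1; ring.
by split=> h t Jt; have := h t Jt; rewrite eqE.
Qed.
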